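(* Let $\mathcal{P}$ be a collection of probability distributions on $\mathcal{Z}^{n+1}$, let $P_*^{Z^n}$ be a probability distribution on $\mathcal{Z}^n$, let $\mu^{|Z^n}$ be a $Z^n$-dependent probability kernel from $\mathcal{Z}^n$ to $\mathcal{Z}$, and let $U:[0,\infty]\to[-\infty,\infty]$ be a utility function. Then a fuzzy prediction set $\mathcal{E}^{Z^n}$ that is valid for $\mathcal{P}$ maximizes $$\mathrm{E}^{P_*^{Z^n}}\left[\int_{\mathcal{Z}}U\left(\mathcal{E}^{Z^n}(z)\right)\,d\mu^{|Z^n}(z)\right]$$ over all fuzzy prediction sets that are valid for $\mathcal{P}$ if and only if the e-value $\mathcal{E}$, $\mathcal{E}(z^n,z)=\mathcal{E}^{z^n}(z)$, is the $U$-expected-utility optimal e-value against the alternative $Q=P_*^{Z^n}\otimes\mu^{|Z^n}$.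
   Context: $\mathcal{Z}$ is a measurable sample space and $Z^{n+1}=(Z^n,Z_{n+1})$ denotes a random element of $\mathcal{Z}^{n+1}$. A fuzzy prediction set (equivalently, an e-value) is a measurable map $\mathcal{E}:\mathcal{Z}^{n+1}\to[0,\infty]$, with $\mathcal{E}^{z^n}(z)=\mathcal{E}(z^n,z)$; it is valid for $\mathcal{P}$ if $\mathrm{E}^P[\mathcal{E}(Z^{n+1})]\le1$ for every $P\in\mathcal{P}$. Standing assumption: utility functions are non-decreasing and concave. $\mathcal{E}$ is $U$-expected-utility optimal against $Q$ if it maximizes $\mathrm{E}^Q[U(\mathcal{E})]$ over all e-values that are valid for $\mathcal{P}$. $P_*^{Z^n}\otimes\mu^{|Z^n}$ is the joint distribution on $\mathcal{Z}^{n+1}$ under which $Z^n\sim P_*^{Z^n}$ and $Z_{n+1}$ given $Z^n$ has distribution $\mu^{|Z^n}$. Integrals are extended-real valued; only those $\mathcal{E}$ are considered for which the integral of $U(\mathcal{E})$ under $Q$ is well defined in $[-\infty,\infty]$ (positive or negative part integrable). *)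

(* Defs.v *)
From HB Require Import structures.
From mathcomp Require Import all_boot all_order all_algebra.
From mathcomp Require Import all_classical all_reals all_analysis.
From mathcomp Require Import measurable_realfun.

Set Implicit Arguments.
Unset Strict Implicit.
Unset Printing Implicit Defensive.

Import Order.TTheory GRing.Theory Num.Theory.
Import numFieldNormedType.Exports.

Local Open Scope classical_set_scope.
Local Open Scope ring_scope.
Local Open Scope ereal_scope.

Section joint_law.
Context d1 d2 (X : measurableType d1) (Y : measurableType d2) (R : realType).
Variables (P : probability X R) (k : R.-pker X ~> Y).

(* P \otimes k: the first component has law P and, given that it equals x,
   the second one has law k x *)
Definition joint_law (A : set (X * Y)) : \bar R :=
  \int[P]_x k x (xsection A x).

Let joint_law0 : joint_law set0 = 0.
Proof. by apply: integral0_eq => x _; rewrite xsection0 measure0. Qed.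

Let joint_law_ge0 A : 0 <= joint_law A.
Proof. by apply: integral_ge0 => x _; exact: measure_ge0. Qed.

Let joint_law_sigma_additive : semi_sigma_additive joint_law.
Proof.
move=> F mF tF mUF.
have -> : joint_law (\bigcup_i F i) = \sum_(i <oo) joint_law (F i).
  rewrite /joint_law -integral_nneseries//; last first.
    by move=> i; apply: measurable_fun_xsection_finite_kernel; rewrite inE.
  apply: eq_integral => x _; apply/esym/cvg_lim => //=; rewrite xsection_bigcup.
  apply: (measure_sigma_additive _ (trivIset_xsection tF)) => ?.
  exact: measurable_xsection.
by apply: is_cvg_ereal_nneg_natsum_cond => *; exact: joint_law_ge0.
Qed.

HB.instance Definition _ :=
  isMeasure.Build _ _ _ joint_law joint_law0 joint_law_ge0
    joint_law_sigma_additive.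

Let joint_law_setT : joint_law setT = 1.
Proof.
rewrite /joint_law (eq_integral (cst 1)) ?integral_cst ?mul1e//.
  exact: probability_setT.
move=> x _; rewrite (_ : xsection setT x = setT) ?prob_kernel//.
by rewrite xsectionE.
Qed.

HB.instance Definition _ := Measure_isProbability.Build _ _ _ joint_law
  joint_law_setT.

End joint_law.

(* The restriction of U to [0, +oo] is a non-decreasing concave function.
   In \bar R one has -oo + +oo = -oo and 0 * +oo = 0 * -oo = 0, so that the
   inequality below is convexity of the hypograph {(x, r) | r%:E <= U x} (it
   requires nothing when the right-hand side is of the form -oo + +oo).
   The values of U outside [0, +oo] play no role. *)
Definition utility (R : realType) (U : \bar R -> \bar R) : Prop :=
  (forall x y, 0 <= x -> x <= y -> U x <= U y) /\
  (forall x y (t : R), 0 <= x -> 0 <= y -> (0 <= t <= 1)%R ->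
     t%:E * U x + (1 - t)%:E * U y <= U (t%:E * x + (1 - t)%:E * y)).

(* \int[mu]_x f x is total, equal to the difference of the
   integrals of f^\+ and f^\- with the convention +oo - +oo = -oo. *)
Definition integral_defined d (T : measurableType d) (R : realType)
    (mu : {measure set T -> \bar R}) (f : T -> \bar R) : Prop :=
  \int[mu]_x f^\+ x < +oo \/ \int[mu]_x f^\- x < +oo.

Definition maximizes (T : Type) (R : realType) (C : set T) (J : T -> \bar R)
    (x : T) : Prop :=
  C x /\ forall y, C y -> J y <= J x.

Section evalues.
Context d (T : measurableType d) (R : realType).

Definition is_evalue (E : T -> \bar R) : Prop :=
  measurable_fun setT E /\ forall w, 0 <= E w.

Definition valid (PP : set (probability T R)) (E : T -> \bar R) : Prop :=
  forall P, PP P -> \int[P]_w E w <= 1.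

Definition utility_optimal (PP : set (probability T R)) (U : \bar R -> \bar R)
    (Q : probability T R) (E : T -> \bar R) : Prop :=
  maximizes
    [set E' | [/\ is_evalue E', valid PP E' & integral_defined Q (U \o E')]]
    (fun E' => \int[Q]_w U (E' w)) E.

End evalues.

(* Z^(n+1) is (n.-tuple Z * Z), that is Z^n x Z with its product
   sigma-algebra. *)
Section fuzzy_prediction_sets.
Context d (Z : measurableType d) (R : realType) (n : nat).

Definition evalue_of (F : n.-tuple Z -> Z -> \bar R) :
  n.-tuple Z * Z -> \bar R := fun w => F w.1 w.2.

Definition fuzzy_prediction_set (F : n.-tuple Z -> Z -> \bar R) : Prop :=
  is_evalue (evalue_of F).

(* The inner integral may be undefined for some zn, but only on a Pstar-null
   set for those F which are considered. *)
Definition mean_utility (U : \bar R -> \bar R) (Pstar : probability (n.-tuple Z) R)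
    (mu : R.-pker (n.-tuple Z) ~> Z) (F : n.-tuple Z -> Z -> \bar R) : \bar R :=
  \int[Pstar]_zn \int[mu zn]_z U (F zn z).

End fuzzy_prediction_sets.

(* Main.v *)
(* The objective function over fuzzy prediction sets is the iterated integral of
   U(E) and the one over e-values is the integral of U(E) under the joint law, so
   the two maximization problems coincide by Fubini's theorem. Monotonicity makes
   U(E) measurable. Since U(E) is signed and extended-real valued, Tonelli's
   theorem is applied to its positive and negative parts, one of which has a
   finite integral; this finiteness allows the difference to be taken inside the
   outer integral. *)
Require Import Defs.
From mathcomp Require Import all_boot all_order all_algebra.
From mathcomp Require Import all_classical all_reals all_analysis.
From mathcomp Require Import measurable_realfun.
From mathcomp Require Import lra.

Local Open Scope classical_set_scope.

Import Order.TTheory GRing.Theory Num.Theory.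
Import HBNNSimple.
Local Open Scope ring_scope.
Local Open Scope ereal_scope.

Section joint_law_integral.
Context d1 d2 (X : measurableType d1) (Y : measurableType d2) (R : realType).
Variables (P : probability X R) (k : R.-pker X ~> Y).

(** On indicators this unfolds the definition of [joint_law]: a section of an indicator is the
    indicator of the section. *)
Lemma integral_joint_law_indic (A : set (X * Y)) : measurable A ->
  \int[joint_law P k]_w (\1_A w)%:E = \int[P]_x \int[k x]_y (\1_A (x, y))%:E.
Proof.
move=> mA; rewrite integral_indic// setIT.
apply: eq_integral => x _.
rewrite (eq_integral (fun y => (\1_(xsection A x) y)%:E)); last first.
  by move=> y _; rewrite !indicE mem_xsection.
by rewrite integral_indic ?setIT//; exact: measurable_xsection.
Qed.

Lemma integral_joint_law_nnsfun (f : {nnsfun (X * Y)%type >-> R}) :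
  \int[joint_law P k]_w (f w)%:E = \int[P]_x \int[k x]_y (f (x, y))%:E.
Proof.
have mpre r : measurable (f @^-1` [set r]) by [].
have mterm r : measurable_fun setT
    (fun w : X * Y => (r * \1_(f @^-1` [set r]) w)%:E).
  exact/measurable_EFinP/measurableT_comp.
have msec r x : measurable_fun setT
    (fun y : Y => (r * \1_(f @^-1` [set r]) (x, y))%:E).
  exact: measurableT_comp (mterm r) (measurable_pair1 x).
have term0 r w : 0 <= (r * \1_(f @^-1` [set r]) w)%:E.
  by rewrite nnfun_muleindic_ge0.
under eq_integral => w _ do rewrite fimfunE -fsumEFin//.
rewrite ge0_integral_fsum//.
under [RHS]eq_integral => x _.
  under eq_integral => y _ do rewrite fimfunE -fsumEFin//.
  rewrite ge0_integral_fsum//.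
  over.
rewrite ge0_integral_fsum//; last 2 first.
- move=> r.
  exact: (measurable_fun_integral_finite_kernel _ k (term0 r) (mterm r)).
- by move=> r x _; apply: integral_ge0.
apply: eq_fsbigr => r _.
(* The sum was compared for arbitrary [r], while scaling an integral needs [0 <= r]. For negative
   [r] the fibre of [f] is empty and both sides vanish. *)
have [r0|r0] := ltP r 0%R.
  have e0 w : (r * \1_(f @^-1` [set r]) w)%:E = 0 :> \bar R.
    by rewrite preimage_nnfun0// indic0 mulr0.
  rewrite integral0_eq; last by move=> w _; exact: e0.
  by rewrite integral0_eq// => x _; rewrite integral0_eq// => y _; exact: e0.
under eq_integral do rewrite EFinM.
rewrite ge0_integralZl//; last exact/measurable_EFinP.
rewrite integral_joint_law_indic// -ge0_integralZl//; last 2 first.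
- by apply: (measurable_fun_integral_finite_kernel
    (fun w => (\1_(f @^-1` [set r]) w)%:E) k) => //; exact/measurable_EFinP.
- by move=> x _; exact: integral_ge0.
apply: eq_integral => x _; rewrite -ge0_integralZl//.
by apply/measurable_EFinP; exact: measurableT_comp (measurable_pair1 x).
Qed.

(** Monotone convergence along simple approximations is used three times: under the joint law, under
    [P], and under each [k x]. *)
Lemma ge0_integral_joint_law (f : X * Y -> \bar R) :
  (forall w, 0 <= f w) -> measurable_fun setT f ->
  \int[joint_law P k]_w f w = \int[P]_x \int[k x]_y f (x, y).
Proof.
move=> f0 mf; pose f_ := nnsfun_approx measurableT mf.
have mf_ n : measurable_fun setT (EFin \o f_ n) by exact/measurable_EFinP.
have f_0 n w : 0 <= (f_ n w)%:E by rewrite lee_fin.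
have ndf w : nondecreasing_seq (fun n => (f_ n w)%:E).
  by move=> a b ab; rewrite lee_fin; exact/lefP/nd_nnsfun_approx.
have msec n x : measurable_fun setT (fun y => (f_ n (x, y))%:E).
  exact: measurableT_comp (mf_ n) (measurable_pair1 x).
have limf w : f w = limn (fun n => (f_ n w)%:E).
  by apply/esym/cvg_lim => //; exact: cvg_nnsfun_approx.
under eq_integral do rewrite limf.
rewrite monotone_convergence//.
under eq_fun do rewrite integral_joint_law_nnsfun.
rewrite -monotone_convergence//; last 3 first.
- move=> n.
  exact: (measurable_fun_integral_finite_kernel _ k (f_0 n) (mf_ n)).
- by move=> n x _; exact: integral_ge0.
- by move=> x _ a b ab; apply: ge0_le_integral => // y _; exact: ndf.
apply: eq_integral => x _; rewrite -monotone_convergence//.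
by under [RHS]eq_integral do rewrite limf.
Qed.

End joint_law_integral.

(** This bound and the next control the positive and negative parts of a difference. If both terms
    are +oo, the parts are 0 and +oo, and the bounds persist. *)
Lemma maxe_subl_le (R : realType) (a b : \bar R) : 0 <= a -> 0 <= b ->
  maxe (a - b) 0 <= a.
Proof.
move=> a0 b0; rewrite ge_max a0 andbT.
by have := leeB (lexx a) b0; rewrite sube0.
Qed.

Lemma maxe_subr_le (R : realType) (a b : \bar R) : 0 <= a -> 0 <= b ->
  maxe (- (a - b)) 0 <= b.
Proof.
move=> a0 b0; rewrite ge_max b0 andbT.
case: a b a0 b0 => [a| |] [b| |]; rewrite ?leey ?leNye //= !lee_fin; lra.
Qed.

(** Splitting [a - b] into its two parts, rearranged into sums of nonnegative terms, so that it can
    be integrated by additivity. *)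
Lemma maxe_sub_balance (R : realType) (a b : \bar R) : 0 <= a -> 0 <= b ->
 (a \is a fin_num) || (b \is a fin_num) ->
  maxe (a - b) 0 + b = a + maxe (- (a - b)) 0.
Proof.
case: a b => [a| |] [b| |] //= _ _ _;
  rewrite ?oppeK /maxe/= ?ltNyr ?ltry ?lt0y ?lte_fin//=.
by case: ifPn; case: ifPn => ? ?; rewrite -!EFinD; congr EFin; lra.
Qed.

(* If one of the integrals is finite, then [f] or [g] is finite almost
   everywhere, so that the convention [+oo - +oo = -oo] in [f x - g x] only
   matters on a null set. *)
Lemma ge0_integralB d (T : measurableType d) (R : realType)
    (m : {measure set T -> \bar R}) (f g : T -> \bar R) :
  measurable_fun setT f -> measurable_fun setT g ->
  (forall x, 0 <= f x) -> (forall x, 0 <= g x) ->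
  \int[m]_x f x < +oo \/ \int[m]_x g x < +oo ->
  \int[m]_x (f x - g x) = \int[m]_x f x - \int[m]_x g x.
Proof.
move=> mf mg f0 g0 fing.
pose h x := f x - g x.
have mh : measurable_fun setT h by exact: emeasurable_funB.
have mhp : measurable_fun setT h^\+ by exact: measurable_funepos.
have mhn : measurable_fun setT h^\- by exact: measurable_funeneg.
have ge0_fin (u : T -> \bar R) : measurable_fun setT u -> (forall x, 0 <= u x) ->
    \int[m]_x u x < +oo -> {ae m, forall x, u x \is a fin_num}.
  move=> mu u0 finu.
  have : m.-integrable setT u.
    apply/integrableP; split => //.
    by under eq_integral do rewrite gee0_abs//.
  by move/(integrable_ae measurableT); apply: filterS => x; exact.
have aefg : {ae m, forall x, (f x \is a fin_num) || (g x \is a fin_num)}.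
  by case: fing => [/(ge0_fin _ mf f0)|/(ge0_fin _ mg g0)]; apply: filterS
    => x ->; rewrite ?orbT.
have hpE x : h^\+ x = maxe (f x - g x) 0 by rewrite funeposE.
have hnE x : h^\- x = maxe (- (f x - g x)) 0 by rewrite funenegE.
have balance : \int[m]_x h^\+ x + \int[m]_x g x =
    \int[m]_x f x + \int[m]_x h^\- x.
  rewrite -ge0_integralD// -[RHS]ge0_integralD//.
  apply: ge0_ae_eq_integral => //.
  - exact: emeasurable_funD.
  - exact: emeasurable_funD.
  - by move=> x _; rewrite adde_ge0.
  - by move=> x _; rewrite adde_ge0.
  by apply: filterS aefg => x fg _; rewrite hpE hnE maxe_sub_balance.
rewrite [LHS]integralE -/h.
have : \int[m]_x h^\+ x <= \int[m]_x f x.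
  by apply: ge0_le_integral => // x _; rewrite hpE maxe_subl_le.
have : \int[m]_x h^\- x <= \int[m]_x g x.
  by apply: ge0_le_integral => // x _; rewrite hnE maxe_subr_le.
move: fing balance.
have : 0 <= \int[m]_x h^\+ x by exact: integral_ge0.
have : 0 <= \int[m]_x h^\- x by exact: integral_ge0.
have : 0 <= \int[m]_x f x by exact: integral_ge0.
have : 0 <= \int[m]_x g x by exact: integral_ge0.
(* If exactly one of the integrals of [f] and [g] is infinite, the bounds and [balance] make both
   sides the same infinity. Otherwise all four are real and [balance] is solved for the
   difference. *)
case: (\int[m]_x h^\+ x) (\int[m]_x h^\- x) (\int[m]_x f x) (\int[m]_x g x)
  => [p| |] [q| |] [a| |] [b| |] //= _ _ _ _ [] //.
- by move=> _ [balance] _ _; congr EFin; lra.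
- by move=> _ [balance] _ _; congr EFin; lra.
Qed.

Lemma integral_joint_law d1 d2 (X : measurableType d1) (Y : measurableType d2)
    (R : realType) (P : probability X R) (k : R.-pker X ~> Y)
    (f : X * Y -> \bar R) :
  measurable_fun setT f -> integral_defined (joint_law P k) f ->
  \int[joint_law P k]_w f w = \int[P]_x \int[k x]_y f (x, y).
Proof.
move=> mf; rewrite /integral_defined.
have mfp : measurable_fun setT f^\+ by exact: measurable_funepos.
have mfn : measurable_fun setT f^\- by exact: measurable_funeneg.
have fp0 w : 0 <= f^\+ w by [].
have fn0 w : 0 <= f^\- w by [].
rewrite [in LHS]integralE !ge0_integral_joint_law// => fin.
rewrite -ge0_integralB//.
- apply: eq_integral => x _; rewrite [RHS]integralE.
  by congr (_ - _); apply: eq_integral => y _;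
    rewrite ?funeposE ?funenegE.
- exact: (measurable_fun_integral_finite_kernel _ k fp0 mfp).
- exact: (measurable_fun_integral_finite_kernel _ k fn0 mfn).
- by move=> x; exact: integral_ge0.
- by move=> x; exact: integral_ge0.
Qed.

(* Superlevel sets are upward closed, hence rays starting at their infimum. *)
Lemma nondecreasing_emeasurable (R : realType) (V : \bar R -> \bar R) :
  {homo V : x y / x <= y} -> measurable_fun setT V.
Proof.
move=> ndV; apply: (measurability _ (ErealGenCInfty.measurableE R)) => //.
move=> _ [_ [r ->] <-]; rewrite setTI.
set S := V @^-1` _.
have upS x y : S x -> x <= y -> S y.
  rewrite /S /= !in_itv/= !andbT => rx xy; exact: le_trans (ndV _ _ xy).
(* The ray is closed or open according to whether the infimum is attained. An empty [S] has infimum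
   +oo and falls in the open case. *)
have [Si|nSi] := pselect (S (ereal_inf S)).
  suff -> : S = `[ereal_inf S, +oo[%classic by exact: emeasurable_itv.
  apply/seteqP; split=> x /=; rewrite in_itv/= andbT.
    exact: ereal_inf_lbound.
  exact: upS.
suff -> : S = `]ereal_inf S, +oo[%classic by exact: emeasurable_itv.
apply/seteqP; split=> x /=; rewrite in_itv/= andbT.
  move=> Sx; rewrite lt_neqAle ereal_inf_lbound// andbT.
  by apply/eqP => ix; apply: nSi; rewrite ix.
by move=> /ereal_inf_lt[y Sy /ltW]; exact: upS.
Qed.

Lemma measurable_utility d (T : measurableType d) (R : realType)
    (U : \bar R -> \bar R) (E : T -> \bar R) :
  utility U -> is_evalue E -> measurable_fun setT (U \o E).
Proof.
move=> [ndU _] [mE E0].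
(* [U] is monotone only on [0, +oo]. Truncating its argument at 0 gives a function monotone
   everywhere without changing its values along [E]. *)
rewrite (_ : U \o E = (fun x => U (maxe x 0)) \o E); last first.
  by apply/funext => w /=; rewrite (max_idPl (E0 w)).
apply: measurableT_comp => //; apply: nondecreasing_emeasurable => x y xy.
apply: ndU; first by rewrite le_max lexx orbT.
by rewrite ge_max !le_max xy lexx orbT.
Qed.

Theorem theorem5 (R : realType) (d : measure_display) (Z : measurableType d)
    (n : nat) (PP : set (probability (n.-tuple Z * Z)%type R))
    (Pstar : probability (n.-tuple Z) R) (mu : R.-pker (n.-tuple Z) ~> Z)
    (U : \bar R -> \bar R) (F : n.-tuple Z -> Z -> \bar R) :
  utility U ->
  fuzzy_prediction_set F ->
  valid PP (evalue_of F) ->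
  maximizes
    [set F' : n.-tuple Z -> Z -> \bar R |
      [/\ fuzzy_prediction_set F',
          valid PP (evalue_of F') &
          integral_defined (joint_law Pstar mu) (U \o evalue_of F')]]
    (mean_utility U Pstar mu) F
  <->
  utility_optimal PP U (joint_law Pstar mu) (evalue_of F).
Proof.
move=> uU fF vF.
(* The two objectives agree at every admissible competitor. *)
have meanE F' : fuzzy_prediction_set F' ->
    integral_defined (joint_law Pstar mu) (U \o evalue_of F') ->
    mean_utility U Pstar mu F' =
    \int[joint_law Pstar mu]_w U (evalue_of F' w).
  move=> fF' dF'; rewrite (@integral_joint_law _ _ _ _ _ _ _ (U \o evalue_of F'))//.
  exact: measurable_utility.
split=> -[[_ _ dF] maxF]; split=> //.
- move=> E' [eE' vE' dE'].
  (* Currying inverts [evalue_of], so each competing e-value comes from a fuzzy prediction set. *)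
  have E'E : E' = evalue_of (fun x y => E' (x, y)).
    by apply/funext => -[].
  rewrite -meanE// E'E -meanE -?E'E//; last by rewrite /fuzzy_prediction_set -E'E.
  by apply: maxF; rewrite /= /fuzzy_prediction_set -E'E.
- by move=> F' [fF' vF' dF']; rewrite !meanE//; exact: maxF.
Qed.
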